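(* Let $D_n=(N,A)$ be the complete digraph on $n\ge 6$ nodes and let $c=(c_1,\dots,c_m)$ be a cardinality sequence with $m\ge 3$, $c_1\ge 2$, $c_m\le n$, and $c_{p+2}=c_{p+1}+2=c_p+4$ for some $2\le p\le m-2$. Let $N=P\,\dot\cup\,Q\,\dot\cup\,\{r\}$ be a partition of $N$ where $1\in P$ and $|P|=c_p+1=c_{p+1}-1$. Then the modified cardinality forcing inequality \[\sum_{v\in P}x(\delta^{\mathrm{out}}(v))-\sum_{v\in Q}x(\delta^{\mathrm{out}}(v))+x((Q:\{r\}))-x((P:\{r\}))\le c_p\] defines a facet of $P^*=\{x\in P_C^{c}(D_n): x(\delta^{\mathrm{out}}(1))=1\}$.
   Context: $D_n=(N,A)$ is the complete digraph with $N=\{1,\dots,n\}$, $A=\{(i,j):i\ne j\}$. A cardinality sequence is a sequence of integers $1\le c_1<\dots<c_m\le n$. $P_C^{c}(D_n)$ is the convex hull in $\mathbb{R}^A$ of incidence vectors of simple directed cycles of $D_n$ with number of arcs in $\{c_1,\dots,c_m\}$. $\delta^{\mathrm{out}}(v)$ is the set of arcs leaving $v$; $(S:T)=\{(i,j)\in A: i\in S,j\in T\}$; $x(F)=\sum_{a\in F}x_a$. *)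

(* Defs.v *)
From mathcomp Require Import all_boot all_order all_algebra.
From mathcomp Require Import classical_sets reals.

Set Implicit Arguments.
Unset Strict Implicit.
Unset Printing Implicit Defensive.

Import GRing.Theory Num.Theory.

Local Open Scope ring_scope.
Local Open Scope classical_set_scope.

Section Polyhedra.
Variables (R : realType) (E : lmodType R).

Definition conv_hull (S : set E) : set E :=
  [set x | exists k (l : 'I_k -> R) (v : 'I_k -> E),
    [/\ forall i, 0 <= l i, \sum_(i < k) l i = 1, forall i, S (v i)
      & x = \sum_(i < k) l i *: v i]].

Definition affinely_independent k (v : 'I_k -> E) : Prop :=
  forall l : 'I_k -> R,
    \sum_(i < k) l i = 0 -> \sum_(i < k) l i *: v i = 0 -> forall i, l i = 0.

(* Dimension d: the maximum size of an affinely independent family of points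
   of S is d + 1; in particular S is nonempty. *)
Definition has_dim (S : set E) (d : nat) : Prop :=
  (exists v : 'I_d.+1 -> E, (forall i, S (v i)) /\ affinely_independent v) /\
  (forall k (v : 'I_k -> E),
     (forall i, S (v i)) -> affinely_independent v -> (k <= d.+1)%N).

Definition defines_facet (P : set E) (f : E -> R) (b : R) : Prop :=
  (forall x, P x -> f x <= b) /\
  exists d, has_dim P d.+1 /\ has_dim [set x | P x /\ f x = b] d.

End Polyhedra.

(* The nodes 1, ..., n are represented by 0, ..., n - 1 in 'I_n. *)
Definition arc (n : nat) := {a : 'I_n * 'I_n | a.1 != a.2}.

Definition arc_tail n (a : arc n) : 'I_n := (val a).1.
Definition arc_head n (a : arc n) : 'I_n := (val a).2.

Definition delta_out n (v : 'I_n) : {set arc n} := [set a | arc_tail a == v]%SET.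

Definition arcs_between n (S T : {set 'I_n}) : {set arc n} :=
  [set a | (arc_tail a \in S) && (arc_head a \in T)]%SET.

(* Since the relation [!=] is irreflexive, a nonempty [ucycle] has at least
   two nodes; cycles (i, j), (j, i) with two arcs are allowed. *)
Definition is_dicycle n (C : {set arc n}) : Prop :=
  exists s : seq 'I_n,
    [/\ s != [::], ucycle (fun i j : 'I_n => i != j) s
      & C = [set a | (arc_tail a \in s) && (arc_head a == next s (arc_tail a))]%SET].

(* c_i, with indices starting from 1 *)
Definition term m (c : m.-tuple nat) (i : nat) : nat := nth 0%N c i.-1.

Definition cardinality_sequence n m (c : m.-tuple nat) : Prop :=
  sorted ltn c /\ {in c, forall k, (1 <= k <= n)%N}.

(* R^A; [R^o] gives access to the scaling [*:]. *)
Definition arc_space (R : realType) n := {ffun arc n -> R^o}.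

Section CyclePolytope.
Variables (R : realType) (n : nat).

Definition incidence (C : {set arc n}) : arc_space R n :=
  [ffun a => (a \in C)%:R].

Definition arc_sum (x : arc_space R n) (F : {set arc n}) : R :=
  \sum_(a in F) x a.

Definition cycle_polytope m (c : m.-tuple nat) : set (arc_space R n) :=
  conv_hull [set x | exists C : {set arc n},
    [/\ is_dicycle C, #|C| \in c & x = incidence C]].

Definition cycle_polytope_through m (c : m.-tuple nat) (v : 'I_n) :
    set (arc_space R n) :=
  [set x | cycle_polytope c x /\ arc_sum x (delta_out v) = 1].

End CyclePolytope.

(* Main.v *)
Require Import Defs.
From HB Require Import structures.
From mathcomp Require Import all_boot all_order all_algebra.
From mathcomp Require Import boolp classical_sets reals.
From mathcomp Require Import zify ring lra.
Import Order.TTheory GRing.Theory Num.Theory.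
Local Open Scope ring_scope.

Set Implicit Arguments.
Unset Strict Implicit.
Unset Printing Implicit Defensive.

(* Write k = c_p. On P* the functional x(delta_out 1) is constantly 1, so affine
   and linear independence coincide there, and it suffices to show that an arc
   weight w whose sum vanishes on every tight cycle through node 1 has
   w(C) = M (f(C) - k) on all cycles C through 1, where f is the left-hand side
   of the inequality: a single non-tight cycle then forces M = 0.

   Adding a potential difference l_i - l_j to w does not change cycle sums, so
   let w(x, r) = 0 for x in P. Moving r past its predecessor in Hamiltonian
   cycles of P + r gives w(i, u) = w(r, u) + M on P. Comparing a k-cycle in P
   with a Hamiltonian cycle of P + r gives w(r, u) = 0 for u <> 1, and then
   w(r, 1) = - k M. Hence w(i, j) + k M [j = 1] - M f(i, j) vanishes on P + r.
   The tight cycles that run through one or two nodes of Q show that this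
   weight is a potential difference on the whole digraph. *)

(** * Faces of convex hulls and a linear criterion for facets *)

Section FacetCriterion.
Variables (R : realType) (E : vectType R).
Implicit Types (S A : set E) (X : seq E) (f g h : {scalar E}).

(** The weighted slacks [l i * (b - g (v i))] are nonnegative and sum to 0, so every point with a
    nonzero coefficient attains the bound. *)
Lemma conv_hull_face S g b x :
    (forall y, S y -> g y <= b) -> conv_hull S x -> g x = b ->
  conv_hull [set y | S y /\ g y = b]%classic x.
Proof.
move=> gb [k [l [v [l0 l1 Sv ->]]]].
rewrite linear_sum /= => gE.
have H0 : \sum_(i < k) l i * (b - g (v i)) = 0.
  under eq_bigr do rewrite mulrBr -linearZ.
  by rewrite sumrB -mulr_suml l1 mul1r gE subrr.
have Hi i : l i * (b - g (v i)) = 0.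
  apply: (psumr_eq0P _ H0) => // j _.
  by rewrite mulr_ge0 // subr_ge0; exact: gb.
have gv i : l i != 0 -> g (v i) = b.
  move=> li; move/eqP: (Hi i); rewrite mulf_eq0 (negPf li) /= subr_eq0.
  by move/eqP.
have [i0 li0] : exists i, l i != 0.
  apply/existsP; apply: contraTT (oner_neq0 R) => /existsPn H.
  rewrite negbK -l1 big1 // => i _.
  by apply/eqP; have := H i; rewrite negbK.
(* Points with coefficient 0 may lie off the face; they are replaced by [v i0], which lies on it. *)
exists k, l, (fun i => if l i == 0 then v i0 else v i); split => //.
  by move=> i /=; case: eqVneq => [_|/gv]; split => //; apply: gv.
by apply: eq_bigr => i _; case: eqVneq => // ->; rewrite !scale0r.
Qed.

Lemma conv_hull_sub S x : S x -> conv_hull S x.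
Proof.
move=> Sx; exists 1%N, (fun=> 1), (fun=> x).
by split=> //; rewrite big_ord1 ?scale1r.
Qed.

Lemma conv_hull_span S X x :
  (forall y, S y -> y \in <<X>>%VS) -> conv_hull S x -> x \in <<X>>%VS.
Proof.
move=> SX [k [l [v [_ _ Sv ->]]]].
by apply: memv_suml => i _; rewrite memvZ ?SX.
Qed.

(** [has_dim] asks for independent points of the set itself, so a basis of the span has to be
    selected from [X]. *)
Lemma exists_free_subset X :
  exists2 Y, {subset Y <= X} & free Y /\ <<Y>>%VS = <<X>>%VS.
Proof.
elim: X => [|x X [Y YX [Yf YE]]].
  by exists [::]; rewrite // nil_free.
have [xY|xY] := boolP (x \in <<Y>>%VS).
  exists Y; first by move=> y /YX yX; rewrite inE yX orbT.
  split=> //; rewrite span_cons -YE.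
  by apply/esym/addv_idPr; rewrite -memvE.
exists (x :: Y).
  by move=> y; rewrite !inE => /orP[->//|/YX ->]; rewrite orbT.
by rewrite free_cons xY Yf !span_cons YE.
Qed.

(* On a hyperplane missing the origin, affine and linear independence agree. *)
Lemma has_dim_span A X h d :
    (forall x, x \in X -> A x) -> (forall x, A x -> x \in <<X>>%VS) ->
    (forall x, A x -> h x = 1) -> \dim <<X>>%VS = d.+1 ->
  has_dim A d.
Proof.
move=> XA AX h1 dX; split.
  have [Y YX [Yf YE]] := exists_free_subset X.
  have sY : size Y == d.+1 by rewrite -dX -YE; move: Yf; rewrite /free eq_sym.
  pose T : d.+1.-tuple E := Tuple sY.
  exists (tnth T); split; first by move=> i; apply/XA/YX/mem_tnth.
  move=> l _ lv i; have /freeP Tf : free T by [].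
  apply: Tf; rewrite -[RHS]lv; apply: eq_bigr => j _.
  by rewrite (tnth_nth 0).
move=> k v Av vi; rewrite -dX.
pose T : k.-tuple E := [tuple v i | i < k].
have Tf : free T.
  apply/freeP => l lT; have lv : \sum_(i < k) l i *: v i = 0.
    by rewrite -[RHS]lT; apply: eq_bigr => i _; rewrite -tnth_nth tnth_mktuple.
  apply: vi => //; have /(congr1 h) := lv.
  rewrite linear0 linear_sum => hl; rewrite -[RHS]hl; apply: eq_bigr => i _.
  by rewrite linearZ /= h1 // mulr1.
have := Tf; rewrite /free size_tuple => /eqP <-.
by apply/dimvS/span_subvP => _ /mapP[i _ ->]; apply: AX.
Qed.

(** The residual [v - projv U v] is nonzero, so one of its coordinates is; that coordinate of the
    residual kills [U]. *)
Lemma separating_functional (U : {vspace E}) v :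
  v \notin U -> exists2 g : {scalar E}, (forall u, u \in U -> g u = 0) & g v != 0.
Proof.
move=> vU; pose B := vbasis {:E}%VS.
pose g i : {scalar E} := coord B i \o (\1 - projv U)%VF.
have gE i x : g i x = coord B i (x - projv U x).
  by rewrite /g /= !lfunE /= !lfunE.
have /existsP[i gv] : [exists i, g i v != 0].
  apply: contraNT vU => /existsPn g0.
  have : v - projv U v = 0.
    rewrite (coord_vbasis (memvf (v - projv U v))) big1 // => i _.
    by have := g0 i; rewrite negbK gE => /eqP ->; rewrite scale0r.
  by move/eqP; rewrite subr_eq0 => /eqP ->; rewrite memv_proj.
exists (g i) => // u uU.
by rewrite gE projv_id // subrr linear0.
Qed.

(** As h <= 1 on [X], the slice h = 1 is the hull of the points [T] of [X] with h = 1, and its face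
    is the hull of the points [F] of [T] with f = b. By duality the hypothesis on functionals says
    that [x0] and [F] together span [T], so the dimension drops by exactly one. *)
Lemma facet_criterion X h f b x0 :
    (forall x, x \in X -> h x <= 1) -> (forall x, x \in X -> f x <= b) ->
    (exists x, [/\ x \in X, h x = 1 & f x = b]) ->
    x0 \in X -> h x0 = 1 -> f x0 != b ->
    (forall g, (forall x, x \in X -> h x = 1 -> f x = b -> g x = 0) ->
       g x0 = 0 -> forall x, x \in X -> h x = 1 -> g x = 0) ->
  defines_facet
    [set x | conv_hull [set y | y \in X]%classic x /\ h x = 1]%classic f b.
Proof.
move=> hX fX [x1 [x1X hx1 fx1]] x0X hx0 fx0 H.
pose T := [seq x <- X | h x == 1].
pose F := [seq x <- T | f x == b].
have FP x : x \in F -> [/\ x \in X, h x = 1 & f x = b].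
  by rewrite !mem_filter => /and3P[/eqP-> /eqP-> ->].
have TP x : x \in T -> x \in X /\ h x = 1.
  by rewrite !mem_filter => /andP[/eqP-> ->].
have FT : (<<F>> <= <<T>>)%VS.
  apply/span_subvP => x; rewrite mem_filter => /andP[_ xT].
  exact: memv_span.
(* The affine equation f = b becomes the linear equation f = b h, which passes to the span and which
   [x0] violates. *)
have fF x : x \in <<F>>%VS -> f x = b * h x.
  move/(@coord_span _ _ _ (in_tuple F)) => ->; rewrite !linear_sum mulr_sumr.
  apply: eq_bigr => i _; rewrite !linearZ /= mulrCA.
  have /FP[_ -> ->] : F`_i \in F by apply: mem_nth.
  by rewrite mulr1.
have x0F : x0 \notin <<F>>%VS.
  by apply: contra fx0 => /fF ->; rewrite hx0 mulr1.
have TE : <<T>>%VS = (<[x0]> + <<F>>)%VS.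
  apply/eqP; rewrite eqEsubv; apply/andP; split; last first.
    rewrite subv_add FT andbT -memvE memv_span //.
    by rewrite mem_filter hx0 eqxx.
  apply/span_subvP => x /TP[xX hx]; apply/negPn/negP.
  move/separating_functional => [g gU /eqP[]].
  apply: H => // [y yX hy fy|].
    apply: gU; apply: (subvP (addvSr _ _)); apply: memv_span.
    by rewrite !mem_filter fy hy yX !eqxx.
  by apply: gU; apply: (subvP (addvSl _ _)); apply: memv_line.
have dT : \dim <<T>>%VS = (\dim <<F>>%VS).+1.
  rewrite TE dimv_disjoint_sum.
    rewrite dim_vline; case: (eqVneq x0 0) => // x00.
    by move: hx0; rewrite x00 linear0 => /eqP; rewrite eq_sym oner_eq0.
  apply/eqP; rewrite -subv0; apply/subvP => y /memv_capP[/vlineP[a ->]].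
  case: (eqVneq a 0) => [->|a0]; rewrite ?scale0r ?mem0v //.
  by rewrite rpredZeq (negPf x0F) (negPf a0).
have dF : (0 < \dim <<F>>%VS)%N.
  rewrite lt0n dimv_eq0; apply/eqP => F0.
  have : x1 \in <<F>>%VS by rewrite memv_span // !mem_filter x1X hx1 fx1 !eqxx.
  rewrite F0 memv0 => /eqP x10; move: hx1; rewrite x10 linear0.
  by move/eqP; rewrite eq_sym oner_eq0.
split.
  move=> x [[k [l [v [l0 l1 Sv ->]]]] _].
  rewrite linear_sum -[leRHS]mul1r -l1 mulr_suml; apply: ler_sum => i _.
  by rewrite linearZ; apply: ler_wpM2l => //; apply: fX; apply: Sv.
(* The affine dimension is the linear one minus 1; the predecessor is genuine because [x1] makes the
   span of [F] nonzero. *)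
exists (\dim <<F>>%VS).-1; split.
  apply: (@has_dim_span _ T h); last by rewrite dT prednK.
  - by move=> x /TP[xX hx]; split=> //; apply: conv_hull_sub.
  - move=> x [xX hx]; apply: conv_hull_span (conv_hull_face hX xX hx).
    by move=> y [yX hy]; apply: memv_span; rewrite mem_filter hy eqxx.
  - by move=> x [].
apply: (@has_dim_span _ F h); last by rewrite prednK.
- by move=> x /FP[xX hx fx]; split=> //; split=> //; apply: conv_hull_sub.
- move=> x [[xX hx] fx].
  have fX' y : [set y | y \in X /\ h y = 1]%classic y -> f y <= b.
    by move=> [/fX].
  apply: conv_hull_span (conv_hull_face fX' (conv_hull_face hX xX hx) fx).
  move=> y [[yX hy] fy]; apply: memv_span.
  by rewrite !mem_filter yX hy fy !eqxx.
- by move=> x [[]].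
Qed.

End FacetCriterion.

(** * Weights of paths and cycles given as node sequences *)

Section CycleWeight.
Variables (R : pzRingType) (T : eqType).
Implicit Types (w : T -> T -> R) (x y : T) (s t : seq T).

Fixpoint path_weight w x t : R :=
  if t is y :: t' then w x y + path_weight w y t' else 0.

Definition cycle_weight w s : R :=
  if s is x :: t then path_weight w x (rcons t x) else 0.

Lemma path_weight_cat w x s t :
  path_weight w x (s ++ t) = path_weight w x s + path_weight w (last x s) t.
Proof. by elim: s x => [|y s IH] x /=; rewrite ?add0r // IH addrA. Qed.

Lemma path_weight_rcons w x t y :
  path_weight w x (rcons t y) = path_weight w x t + w (last x t) y.
Proof. by rewrite -cats1 path_weight_cat /= addr0. Qed.

Lemma path_weight_lin w w' (M : R) x t :
  path_weight (fun i j => w i j + M * w' i j) x t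
    = path_weight w x t + M * path_weight w' x t.
Proof.
by elim: t x => [|y t IH] x /=; rewrite ?mulr0 ?addr0 // IH mulrDr addrACA.
Qed.

Lemma cycle_weight_lin w w' (M : R) s :
  cycle_weight (fun i j => w i j + M * w' i j) s
    = cycle_weight w s + M * cycle_weight w' s.
Proof. by case: s => [|x t] /=; rewrite ?mulr0 ?addr0 ?path_weight_lin. Qed.

Lemma path_weight_head (g : T -> R) x t :
  path_weight (fun _ j => g j) x t = \sum_(j <- t) g j.
Proof. by elim: t x => [|y t IH] x /=; rewrite ?big_nil ?big_cons ?IH. Qed.

Lemma cycle_weight_head (g : T -> R) s :
  cycle_weight (fun _ j => g j) s = \sum_(j <- s) g j.
Proof.
case: s => [|x t] /=; first by rewrite big_nil.
by rewrite path_weight_head big_rcons big_cons addrC.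
Qed.

Lemma path_weight_potential (l : T -> R) x t :
  path_weight (fun i j => l i - l j) x t = l x - l (last x t).
Proof.
elim: t x => [|y t IH] x /=; first by rewrite subrr.
by rewrite IH addrA subrK.
Qed.

Lemma cycle_weight_potential (l : T -> R) s :
  cycle_weight (fun i j => l i - l j) s = 0.
Proof. by case: s => //= x t; rewrite path_weight_potential last_rcons subrr. Qed.

Lemma sum_next w s :
  uniq s -> \sum_(x <- s) w x (next s x) = cycle_weight w s.
Proof.
case: s => [|z p]; first by rewrite big_nil.
(* The induction moves the first node, so the closing node [z0] must be independent of it. *)
suff H z0 : uniq (z :: p) -> \sum_(x <- z :: p) w x (next_at x z0 z p)
    = path_weight w z (rcons p z0) by move=> /(H z).
elim: p z => [|y p IH] z /=; first by rewrite big_cons big_nil eqxx.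
move=> /andP[zyp up]; rewrite big_cons eqxx; congr (_ + _).
rewrite -IH //; apply: eq_big_seq => x xyp.
by case: eqVneq zyp => // <-; rewrite xyp.
Qed.

End CycleWeight.

(** * Directed cycles as duplicate-free node sequences *)

Lemma uniq_cycle_neq (T : eqType) (s : seq T) :
  uniq s -> (1 < size s)%N -> cycle (fun i j : T => i != j) s.
Proof.
case: s => [//|x [//|y t]] us _; rewrite (cycle_path x) /=.
have := us; rewrite uniq_pairwise => /pairwise_sorted /= ->; rewrite andbT.
have /andP[] : uniq (x :: y :: t) by [].
by move=> xt _; apply: contraNneq xt => <-; exact: mem_last.
Qed.

Section Dicycles.
Variable n : nat.
Implicit Types (s : seq 'I_n).

Definition dicycle_of s : {set Defs.arc n} :=
  [set a | (arc_tail a \in s) && (arc_head a == next s (arc_tail a))]%SET.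

(** Exactly one arc of the cycle leaves each node [x] of [s], namely the one to [next s x]. *)
Lemma sum_dicycle_of (V : nmodType) (w : 'I_n -> 'I_n -> V) s :
    uniq s -> cycle (fun i j : 'I_n => i != j) s ->
  \sum_(a in dicycle_of s) w (arc_tail a) (arc_head a)
    = \sum_(x <- s) w x (next s x).
Proof.
move=> us cs; rewrite big_uniq //=.
rewrite (partition_big (@arc_tail n) (mem s)) /=; last first.
  by move=> a; rewrite inE => /andP[].
apply: eq_bigr => x xs.
have xn := next_cycle cs xs.
rewrite (big_pred1 (exist _ (x, next s x) xn)) //= => -[[i j] ij].
rewrite inE /arc_tail /arc_head /= -[RHS]val_eqE /= xpair_eqE andbC.
by case: eqVneq => //= ->; rewrite xs.
Qed.

Lemma card_dicycle_of s :
  uniq s -> cycle (fun i j : 'I_n => i != j) s -> #|dicycle_of s| = size s.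
Proof.
move=> us cs; rewrite -sum1_card (sum_dicycle_of (fun _ _ => 1%N) us cs).
exact: sum1_size.
Qed.

Lemma is_dicycleP (C : {set Defs.arc n}) :
  is_dicycle C <->
  exists s, [/\ uniq s, (1 < size s)%N, cycle (fun i j : 'I_n => i != j) s
              & C = dicycle_of s].
Proof.
split.
  case=> s [s0 /andP[cs us] ->]; exists s; split=> //.
  case: s s0 cs {us} => [//|x [|//]] _ /=.
  by rewrite eqxx.
case=> s [us s1 cs ->]; exists s; split=> //; first by case: s s1 {us cs}.
by rewrite /ucycle cs us.
Qed.

End Dicycles.

(** Weights are functions on all ordered pairs, but only off-diagonal pairs are arcs; agreement is
    therefore asked only there. *)
Lemma eq_path_weight_in (R : pzRingType) (T : eqType) (A : {pred T})
    (w w' : T -> T -> R) x t :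
    {in A &, forall i j, i != j -> w i j = w' i j} ->
    x \in A -> {subset t <= A} -> path (fun i j : T => i != j) x t ->
  path_weight w x t = path_weight w' x t.
Proof.
move=> ww'; elim: t x => //= y t IH x xA tA /andP[xy yt].
have yA : y \in A by apply: tA; rewrite mem_head.
rewrite ww' // IH // => z zt; apply: tA; by rewrite inE zt orbT.
Qed.

Lemma uniq_path_neq (T : eqType) (x : T) t :
  uniq (x :: t) -> path (fun i j : T => i != j) x t.
Proof. by rewrite uniq_pairwise => /pairwise_sorted. Qed.

(** * The forcing weight and the weights that vanish on tight cycles *)

Section ForcingWeights.
Variables (R : realFieldType) (n k : nat) (P Q : {set 'I_n}) (r one : 'I_n).

(** The arc coefficients of the inequality, term by term. They amount to 1 on arcs leaving P and -1
    on arcs leaving Q, except that all arcs into or out of r get 0. *)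
Definition forcing (i j : 'I_n) : R :=
  (i \in P)%:R - (i \in Q)%:R
    + ((i \in Q) && (j == r))%:R - ((i \in P) && (j == r))%:R.

Hypothesis cover : forall x, [|| x \in P, x \in Q | x == r].
Hypothesis disjPQ : forall x, x \in P -> x \notin Q.
Hypotheses (rP : r \notin P) (rQ : r \notin Q) (oneP : one \in P).
Hypotheses (cardP : #|P| = k.+1) (k_ge3 : (3 <= k)%N) (cardQ : (1 < #|Q|)%N).

Let neP_r x : x \in P -> (x == r) = false.
Proof. by move=> xP; apply: contraNF rP => /eqP <-. Qed.

Let neQ_r x : x \in Q -> (x == r) = false.
Proof. by move=> xQ; apply: contraNF rQ => /eqP <-. Qed.

Let notPQ x : x \in Q -> (x \in P) = false.
Proof. by move=> xQ; apply: contraTF xQ => /disjPQ. Qed.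

Lemma forcing_P i j : i \in P -> j != r -> forcing i j = 1.
Proof.
move=> iP jr; rewrite /forcing iP (negPf (disjPQ iP)) (negPf jr) /=.
by rewrite subr0 addr0 subr0.
Qed.

Lemma forcing_Pr i : i \in P -> forcing i r = 0.
Proof.
move=> iP; rewrite /forcing iP (negPf (disjPQ iP)) eqxx /=.
by rewrite subr0 addr0 subrr.
Qed.

Lemma forcing_Q i j : i \in Q -> j != r -> forcing i j = -1.
Proof.
move=> iQ jr; rewrite /forcing iQ (notPQ iQ) (negPf jr) /=.
by rewrite sub0r addr0 subr0.
Qed.

Lemma forcing_Qr i : i \in Q -> forcing i r = 0.
Proof.
move=> iQ; rewrite /forcing iQ (notPQ iQ) eqxx /=.
by rewrite sub0r addNr subr0.
Qed.

Lemma forcing_r j : forcing r j = 0.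
Proof. by rewrite /forcing (negPf rP) (negPf rQ) /= !subr0 addr0. Qed.

Lemma path_weight_forcing_P x t :
  x \in P -> {subset t <= P} -> path_weight forcing x t = (size t)%:R.
Proof.
elim: t x => //= y t IH x xP tP.
have yP : y \in P by apply: tP; rewrite mem_head.
rewrite forcing_P ?neP_r // IH ?mulrS // => z zt.
by apply: tP; rewrite inE zt orbT.
Qed.

Lemma exists_P_notin (e : seq 'I_n) :
  (size e <= 3)%N -> exists2 v, v \in P & v \notin e.
Proof.
move=> e3; apply/subsetPn; apply/negP => /subset_leq_card.
rewrite cardP leqNgt => /negP[]; apply: leq_ltn_trans (card_size e) _.
by apply: leq_ltn_trans e3 _; rewrite ltnS.
Qed.

(** Any sequence of distinct nodes is a path in the complete digraph, so a prescribed beginning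
    extends to a listing of all of P. The cycles below arise from such listings by inserting or
    deleting a few nodes. *)
Lemma extend_in_P (e : seq 'I_n) :
    uniq e -> {subset e <= P} ->
  exists t, [/\ uniq (e ++ t), {subset t <= P}, one \in e ++ t
              & (size e + size t = k.+1)%N].
Proof.
move=> ue eP; exists (enum (P :\: [set x in e])); split.
- rewrite cat_uniq ue enum_uniq andbT; apply/hasPn => x.
  by rewrite mem_enum !inE => /andP[].
- by move=> x; rewrite mem_enum !inE => /andP[].
- by rewrite mem_cat mem_enum !inE oneP andbT orbN.
- rewrite -cardE -cardP -(cardsID [set x in e] P); congr (_ + _)%N.
  rewrite -(card_uniqP ue); apply: eq_card => x; rewrite !inE.
  by case: (boolP (x \in e)) => [/eP ->|_]; rewrite ?andbF.
Qed.

(** The three sizes are c_p, c_(p+1) and c_(p+2). *)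
Definition vanishes_on_tight (w : 'I_n -> 'I_n -> R) :=
  forall s, uniq s -> one \in s -> size s \in [:: k; k.+2; k.+4] ->
    cycle_weight forcing s = k%:R -> cycle_weight w s = 0.

(* [h] is a detour from [x] to [j]; the cycle returns from [j] to [x] inside [P]. *)
Lemma vanishes_detour w x h j t e :
    vanishes_on_tight w -> perm_eq (x :: h ++ j :: t) e -> uniq e ->
    one \in e -> size e \in [:: k; k.+2; k.+4] ->
    x \in P -> j \in P -> {subset t <= P} ->
    path_weight forcing x (rcons h j) + (size t).+1%:R = k%:R ->
  path_weight w x (rcons h j) + path_weight w j (rcons t x) = 0.
Proof.
move=> wV se ue oe ke xP jP tP fk.
have cE w' : path_weight w' x (rcons h j) + path_weight w' j (rcons t x)
    = cycle_weight w' (x :: h ++ j :: t).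
  by rewrite /= -cat_rcons rcons_cat path_weight_cat last_rcons.
rewrite cE; apply: wV.
- by rewrite (perm_uniq se).
- by rewrite (perm_mem se).
- by rewrite (perm_size se).
rewrite -cE (path_weight_forcing_P jP) ?size_rcons // => y.
by rewrite mem_rcons inE => /orP[/eqP->|/tP].
Qed.

Lemma uniq_add_r s : {subset s <= P} -> uniq s -> uniq (r :: s).
Proof. by move=> sP us; rewrite /= us andbT; apply: contra rP => /sP. Qed.

(** The Hamiltonian cycles i, u, r, j, t and i, r, u, j, t of P + r are tight: of their k + 2 arcs
    the two at r have forcing weight 0. They share the path from j back to i, so their detours have
    equal weight. *)
Lemma vanishes_swap w i u j :
    vanishes_on_tight w -> (forall x, x \in P -> w x r = 0) ->
    i \in P -> u \in P -> j \in P -> uniq [:: i; u; j] ->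
  w i u - w r u = w u j - w r j.
Proof.
move=> wV wr iP uP jP iuj.
have eP : {subset [:: i; u; j] <= P}.
  by move=> x; rewrite !inE => /or3P[] /eqP->.
have [t [ut tP ot st]] := extend_in_P iuj eP.
have ur : uniq (r :: [:: i; u; j] ++ t).
  by apply: uniq_add_r => // x; rewrite mem_cat => /orP[/eP|/tP].
have or_ : one \in r :: [:: i; u; j] ++ t by rewrite inE ot orbT.
have sr : size (r :: [:: i; u; j] ++ t) \in [:: k; k.+2; k.+4].
  by rewrite /= !inE; clear -st; move: st => /=; lia.
have kE : k%:R = 1 + (size t).+1%:R :> R.
  by rewrite nat1r; congr _%:R; clear -st; move: st => /=; lia.
have H1 : path_weight w i [:: u; r; j] + path_weight w j (rcons t i) = 0.
  apply: (@vanishes_detour w i [:: u; r] j t _ wV _ ur) => //.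
    by clear; apply/permP => a /=; lia.
  by rewrite /= kE forcing_Pr // forcing_r forcing_P ?neP_r // !addr0.
have H2 : path_weight w i [:: r; u; j] + path_weight w j (rcons t i) = 0.
  apply: (@vanishes_detour w i [:: r; u] j t _ wV _ ur) => //.
    by clear; apply/permP => a /=; lia.
  by rewrite /= kE forcing_Pr // forcing_r forcing_P ?neP_r // !add0r addr0.
move: H1 H2; rewrite /= !wr //; lra.
Qed.

(** By [vanishes_swap], [D] agrees on consecutive arcs. As |P| >= 4, arcs of P with a common head
    share a successor and arcs with a common tail share a predecessor, so [D] is constant on P. *)
Lemma vanishes_uniform w :
    vanishes_on_tight w -> (forall x, x \in P -> w x r = 0) ->
  exists M, {in P &, forall i u, i != u -> w i u = w r u + M}.
Proof.
move=> wV wr; pose D i u := w i u - w r u.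
have step i u j : i \in P -> u \in P -> j \in P -> uniq [:: i; u; j] ->
  D i u = D u j by exact: vanishes_swap.
have uniq3 (i u j : 'I_n) : i != u -> i != j -> u != j -> uniq [:: i; u; j].
  by move=> iu ij uj; rewrite /= !inE negb_or iu ij uj.
have head i i' u : i \in P -> i' \in P -> u \in P -> i != u -> i' != u ->
    D i u = D i' u.
  move=> iP i'P uP iu i'u.
  have [//|j jP] := @exists_P_notin [:: i; i'; u].
  rewrite !inE => /norP[ji /norP[ji' ju]].
  rewrite (step i u j) ?(step i' u j) // uniq3 // eq_sym //.
have tail i u u' : i \in P -> u \in P -> u' \in P -> i != u -> i != u' ->
    D i u = D i u'.
  move=> iP uP u'P iu iu'.
  have [//|j jP] := @exists_P_notin [:: i; u; u'].
  rewrite !inE => /norP[ji /norP[ju ju']].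
  by rewrite -(step j i u) -?(step j i u') // uniq3.
have [//|v vP] := @exists_P_notin [:: one]; rewrite inE => v1.
exists (D v one) => i u iP uP iu.
suff <- : D i u = D v one by rewrite /D addrC subrK.
have [u1|u1] := eqVneq u one.
  by rewrite u1 in iu *; apply: head.
have [ui|i1] := eqVneq i one; last first.
  by rewrite (tail i u one) //; apply: head.
(* Here the tail is node 1, and moving the head to 1 would give a loop; the value is carried along
   (one, u), (u, j), (u, one) instead. *)
rewrite ui in iu *; have [//|j jP] := @exists_P_notin [:: one; u].
rewrite !inE => /norP[j1 ju].
rewrite (step one u j) // ?uniq3 // 1?eq_sym //.
by rewrite (tail u j one) //; [apply: head|rewrite eq_sym].
Qed.

Lemma vanishes_on_P w :
    vanishes_on_tight w -> (forall x, x \in P -> w x r = 0) ->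
  exists M, {in P &, forall i u, i != u -> w i u = w r u + M} /\
            {in P, forall u, w r u = - (k%:R * M) * (u == one)%:R}.
Proof.
move=> wV wr; have [M wM] := vanishes_uniform wV wr.
exists M; split=> //.
(* The Hamiltonian cycle r, u, v, 1, t of P + r and the k-cycle v, 1, t are both tight and share the
   path from v to its last node l. Since [w l r = 0] and [w u v = w l v], their difference is
   [w r u]. The condition u != 1 keeps node 1 on the k-cycle. *)
have w0 u : u \in P -> u != one -> w r u = 0.
  move=> uP u1.
  have [//|v vP] := @exists_P_notin [:: one; u]; rewrite !inE => /norP[v1 vu].
  have e3 : uniq [:: u; v; one] by rewrite /= !inE negb_or eq_sym vu u1 v1.
  have eP : {subset [:: u; v; one] <= P}.
    by move=> x; rewrite !inE => /or3P[] /eqP->.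
  have [t [ut tP _ st]] := extend_in_P e3 eP.
  have sP : {subset one :: t <= P} by move=> x; rewrite inE => /orP[/eqP->|/tP].
  have uvP : {subset u :: v :: one :: t <= P}.
    by move=> x; rewrite !inE => /or4P[/eqP->|/eqP->|/eqP->|/tP].
  have /andP[_ uv] : uniq (u :: v :: one :: t) by [].
  have ur := uniq_add_r uvP ut.
  have H1 : cycle_weight w (v :: one :: t) = 0.
    apply: wV => //; first by rewrite !inE eqxx orbT.
      by rewrite !inE; clear -st; move: st => /=; lia.
    rewrite /cycle_weight path_weight_forcing_P //.
      by rewrite size_rcons; congr _%:R; clear -st; move: st => /=; lia.
    by move=> x; rewrite mem_rcons inE => /orP[/eqP->|/sP].
  have H2 : cycle_weight w (r :: u :: v :: one :: t) = 0.
    apply: wV => //; first by rewrite !inE eqxx !orbT.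
      by rewrite !inE; clear -st; move: st => /=; lia.
    have -> : cycle_weight forcing (r :: u :: v :: one :: t) = forcing r u
        + (path_weight forcing u (v :: one :: t)
           + forcing (last u (v :: one :: t)) r) by rewrite -path_weight_rcons.
    rewrite forcing_r add0r forcing_Pr ?addr0.
      rewrite (@path_weight_forcing_P u (v :: one :: t)) //.
        by congr _%:R; clear -st; move: st => /=; lia.
      by move=> x xt; apply: uvP; rewrite inE xt orbT.
    by apply: uvP; apply: mem_last.
  pose l := last v (one :: t).
  have lP : l \in P by apply: uvP; rewrite inE mem_last orbT.
  have lv : l != v.
    have /andP[vt _] := uv; apply: contraNneq vt => lv.
    by rewrite -[X in X \in _]lv; apply: (mem_last one t).
  have E1 : path_weight w v (one :: t) + w l v = 0.
    by rewrite -path_weight_rcons.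
  have E2 : w r u + (w u v + (path_weight w v (one :: t) + w l r)) = 0.
    by rewrite -path_weight_rcons.
  have lvE := wM l v lP vP lv.
  have uvE : w u v = w r v + M by apply: wM; rewrite // eq_sym.
  have lr := wr l lP.
  by lra.
move=> u uP; have [->|/w0 ->//] := eqVneq u one; last by rewrite mulr0.
rewrite mulr1.
(* On a k-cycle through all of P but v, each of the k arcs contributes M and the arc into node 1
   adds [w r one]; the total is 0. *)
have [//|v vP] := @exists_P_notin [:: one]; rewrite inE => v1.
have e2 : uniq [:: v; one] by rewrite /= !inE v1.
have eP : {subset [:: v; one] <= P} by move=> x; rewrite !inE => /orP[] /eqP->.
have [t [ut tP _ st]] := extend_in_P e2 eP.
have sP : {subset rcons t one <= P}.
  by move=> x; rewrite mem_rcons inE => /orP[/eqP->|/tP].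
have /andP[_ us] : uniq (v :: one :: t) by [].
have H1 : cycle_weight w (one :: t) = 0.
  apply: wV => //; first by rewrite !inE eqxx.
    by rewrite !inE; clear -st; move: st => /=; lia.
  rewrite /cycle_weight path_weight_forcing_P //.
  by rewrite size_rcons; congr _%:R; clear -st; move: st => /=; lia.
have : cycle_weight w (one :: t)
    = cycle_weight (fun _ j => w r one * (j == one)%:R + M) (one :: t).
  apply: (@eq_path_weight_in _ _ (mem P)) => //.
    move=> i j iP jP ij; rewrite wM //; congr (_ + _).
    by have [->|/w0 ->] := eqVneq j one; rewrite ?mulr1 ?mulr0.
  have /= := @uniq_cycle_neq _ (one :: t) us; apply.
  by clear -st k_ge3; move: st => /=; lia.
rewrite H1 cycle_weight_head big_split /= -mulr_sumr.
rewrite big_const_seq count_predT iter_addr_0.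
have -> : (size (one :: t)) = k by clear -st; move: st => /=; lia.
rewrite big_cons eqxx big_seq big1 ?addr0 ?mulr1 => [/eqP|i it].
  by rewrite eq_sym addr_eq0 mulr_natl => /eqP.
by case: eqVneq us it => //= -> /andP[/negPf->].
Qed.

(** The potential is [w v one] at v in Q and 0 elsewhere. Each kind of arc at Q is evaluated by a
    tight cycle that makes a short detour out of P. *)
Lemma vanishes_potential w :
    vanishes_on_tight w ->
    {in predC (mem Q) &, forall i j, i != j -> w i j = 0} ->
  exists l, forall i j, i != j -> w i j = l i - l j.
Proof.
move=> wV w0.
have PnQ i : i \in P -> i \in predC (mem Q) by move=> /disjPQ.
have rnQ : r \in predC (mem Q) by [].
have wrP u : u \in P -> w r u = 0.
  by move=> uP; apply: (w0 r u rnQ (PnQ u uP)); rewrite eq_sym neP_r.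
have back j t x : uniq (j :: rcons t x) -> x \in P -> j \in P ->
    {subset t <= P} -> path_weight w j (rcons t x) = 0.
  move=> ut xP jP tP.
  rewrite (@eq_path_weight_in _ _ (mem P) _ (fun _ _ => 0 - 0)) //.
  - by rewrite (path_weight_potential (fun=> 0)) subrr.
  - by move=> a b aP bP ab; rewrite subrr w0 ?PnQ.
  - by move=> y; rewrite mem_rcons inE => /orP[/eqP->|/tP].
  - exact: uniq_path_neq.
(* A detour through 1 or 3 nodes outside P, closed up by all other nodes of P, gives a cycle of size
   k + 2 or k + 4. The return inside P has k arcs and forcing weight k, so a detour of forcing
   weight 0 makes the cycle tight. *)
have key x h j : x \in P -> j \in P -> x != j -> uniq h ->
    {subset h <= predC (mem P)} -> size h \in [:: 1; 3]%N ->
    path_weight forcing x (rcons h j) = 0 ->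
    path_weight w x (rcons h j) = 0.
  move=> xP jP xj uh hP sh fh.
  have e2 : uniq [:: x; j] by rewrite /= inE xj.
  have eP : {subset [:: x; j] <= P} by move=> y; rewrite !inE => /orP[] /eqP->.
  have [t [ut tP ot st]] := extend_in_P e2 eP.
  have := @vanishes_detour w x h j t (h ++ [:: x; j] ++ t) wV.
  rewrite (@back j t x) //; last first.
    by rewrite -rcons_cons rcons_uniq.
  rewrite addr0; apply=> //.
  - by rewrite -cat1s perm_catCA.
  - rewrite cat_uniq uh ut andbT; apply/hasPn => y yt.
    apply/negP => /hP; rewrite !inE; have : y \in [:: x; j] ++ t by [].
    by rewrite mem_cat => /orP[/eP->|/tP->].
  - by rewrite mem_cat ot orbT.
  - rewrite !size_cat !inE; move: sh; rewrite !inE; clear -st; move: st => /=.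
    by lia.
  - rewrite fh add0r; congr _%:R; clear -st; move: st => /=; lia.
have QnP i : i \in Q -> i \in predC (mem P) by move=> /notPQ; rewrite !inE => ->.
have through u v j : v \in Q -> u \in P -> j \in P -> u != j ->
    w u v + w v j = 0.
  move=> vQ uP jP uj.
  have := key u [:: v] j uP jP uj; rewrite /= !addr0; apply=> //.
    by move=> y; rewrite inE => /eqP->; apply: QnP.
  by rewrite forcing_P ?neQ_r // forcing_Q ?neP_r // subrr.
have out v j : v \in Q -> j \in P -> w v j = w v one.
  move=> vQ jP; have [//|u uP] := @exists_P_notin [:: one; j].
  rewrite !inE => /norP[u1 uj].
  have := through u v j vQ uP jP uj; have := through u v one vQ uP oneP u1.
  by lra.
have into v u : v \in Q -> u \in P -> w u v = - w v one.
  move=> vQ uP; have [//|j jP] := @exists_P_notin [:: u]; rewrite inE => ju.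
  have := through u v j vQ uP jP; rewrite eq_sym => /(_ ju).
  by have := out v j vQ jP; lra.
(* The detour 1, v, r, j has forcing weight 1, so [key] does not apply. Leaving out one more node x
   of P lowers the weight of the return to k - 1, and the cycle is tight with k + 2 nodes. *)
have to_r v : v \in Q -> w v r = w v one.
  move=> vQ.
  have [//|j jP] := @exists_P_notin [:: one]; rewrite inE => j1.
  have [//|x xP] := @exists_P_notin [:: one; j]; rewrite !inE => /norP[x1 xj].
  have e3 : uniq [:: x; one; j] by rewrite /= !inE negb_or x1 xj eq_sym j1.
  have eP : {subset [:: x; one; j] <= P}.
    by move=> y; rewrite !inE => /or3P[] /eqP->.
  have [t [ut tP ot st]] := extend_in_P e3 eP.
  have ut1 : uniq (one :: j :: t) by case/andP: ut.
  have oP : {subset one :: j :: t <= P}.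
    by move=> y; rewrite !inE => /or3P[/eqP->|/eqP->|/tP].
  have ue : uniq (r :: v :: one :: j :: t).
    rewrite (cons_uniq r) (cons_uniq v) ut1 andbT in_cons eq_sym neQ_r // orFb.
    apply/andP; split; first by apply: contra rP => /oP.
    by apply: contraFN (notPQ vQ) => /oP.
  have := @vanishes_detour w one [:: v; r] j t (r :: v :: one :: j :: t) wV.
  rewrite (@back j t one) //; last first.
    by rewrite -rcons_cons rcons_uniq.
  rewrite /= into // (wrP j) // !addr0.
  move=> H; apply/esym/eqP; rewrite -subr_eq0 -oppr_eq0 opprB addrC.
  apply/eqP/H => //.
  - by clear; apply/permP => a /=; lia.
  - by rewrite !inE eqxx !orbT.
  - by rewrite !inE; clear -st; move: st => /=; lia.
  - rewrite forcing_P ?neQ_r // forcing_Qr // forcing_r !addr0 nat1r.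
    by congr _%:R; clear -st; move: st => /=; lia.
have [j jP] := @exists_P_notin [:: one] isT; rewrite inE => j1.
have oj : one != j by rewrite eq_sym.
(* The detour 1, u, v, r, j has forcing weight 1 - 1 + 0 + 0. *)
have between u v : u \in Q -> v \in Q -> u != v -> w u v = w u one - w v one.
  move=> uQ vQ uv.
  have := key one [:: u; v; r] j oneP jP oj.
  rewrite /= into // to_r // (wrP j) // !addr0.
  move=> H; suff : - w u one + (w u v + w v one) = 0 by lra.
  apply: H => //.
  - by rewrite !inE negb_or uv !neQ_r.
  - move=> y; rewrite !inE => /or3P[]/eqP->; rewrite ?(negPf rP) //.
      by rewrite notPQ.
    by rewrite notPQ.
  - rewrite forcing_P ?neQ_r // forcing_Q ?neQ_r // forcing_Qr // forcing_r.
    by rewrite !addr0 subrr.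
(* The detour 1, r, v, j has forcing weight -1; passing first through a second node u of Q raises it
   to 0. *)
have from_r v : v \in Q -> w r v = - w v one.
  move=> vQ; have [u uQ uv] : exists2 u, u \in Q & u != v.
    have [u] : exists u, u \in Q :\ v.
      by apply/card_gt0P; move: cardQ; rewrite (cardsD1 v) vQ.
    by rewrite !inE => /andP[]; exists u.
  have := key one [:: u; r; v] j oneP jP oj.
  rewrite /= into // to_r // (out v j) // !addr0.
  move=> H; suff : - w u one + (w u one + (w r v + w v one)) = 0 by lra.
  apply: H => //.
  - by rewrite !inE negb_or uv [r == v]eq_sym !neQ_r.
  - move=> y; rewrite !inE => /or3P[]/eqP->; rewrite ?(negPf rP) //.
      by rewrite notPQ.
    by rewrite notPQ.
  - rewrite forcing_P ?neQ_r // forcing_Qr // forcing_r forcing_Q ?neP_r //.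
    by rewrite !add0r subrr.
exists (fun i => if i \in Q then w i one else 0) => i i' ii'.
case: (boolP (i \in Q)) => iQ; case: (boolP (i' \in Q)) => i'Q.
- exact: between.
- rewrite subr0; have := cover i'; rewrite (negPf i'Q) /= => /orP[/out->//|].
  by move/eqP->; apply: to_r.
- rewrite sub0r; have := cover i; rewrite (negPf iQ) /= => /orP[/into->//|].
  by move/eqP->; apply: from_r.
- by rewrite subrr; apply: w0.
Qed.

Lemma vanishes_forcing w :
    vanishes_on_tight w ->
  exists M, forall s, uniq s -> cycle (fun i j : 'I_n => i != j) s ->
    one \in s -> cycle_weight w s = M * (cycle_weight forcing s - k%:R).
Proof.
move=> wV.
(* This potential makes the arcs from P into r weightless; the factor 1 in [b] gives it the shape of
   [cycle_weight_lin]. *)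
pose l i := if i \in P then - w i r else 0.
pose b i j := w i j + 1 * (l i - l j).
have bE s : cycle_weight b s = cycle_weight w s.
  by rewrite cycle_weight_lin cycle_weight_potential mulr0 addr0.
have bV : vanishes_on_tight b by move=> s us os ss fs; rewrite bE wV.
have br x : x \in P -> b x r = 0.
  by move=> xP; rewrite /b /l xP (negPf rP) mul1r subr0 subrr.
have [M [bM brM]] := vanishes_on_P bV br.
(* On a cycle through node 1, [g] has weight k minus the forcing weight, hence 0 on tight cycles.
   Adding M times [g] cancels what [vanishes_on_P] leaves of [b] on P + r. *)
pose g (i j : 'I_n) : R := k%:R * (j == one)%:R + -1 * forcing i j.
pose b' i j := b i j + M * g i j.
have b'E s : uniq s -> one \in s ->
    cycle_weight b' s = cycle_weight w s + M * (k%:R - cycle_weight forcing s).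
  move=> us os; rewrite cycle_weight_lin bE cycle_weight_lin mulN1r.
  rewrite (cycle_weight_head (fun j => k%:R * (j == one)%:R)) -mulr_sumr.
  rewrite (bigD1_seq one) //= eqxx big1 ?addr0 ?mulr1 // => i /negPf-> //.
have b'V : vanishes_on_tight b'.
  by move=> s us os ss fs; rewrite b'E // wV // fs subrr mulr0 addr0.
have b'0 : {in predC (mem Q) &, forall i j, i != j -> b' i j = 0}.
  move=> i j; rewrite !inE => iQ jQ ij; rewrite /b' /g.
  have := cover i; have := cover j.
  rewrite (negPf iQ) (negPf jQ) /=.
  move=> /orP[jP|/eqP jr] /orP[iP|/eqP ir].
  - rewrite bM // brM // forcing_P ?neP_r //; ring.
  - rewrite ir brM // forcing_r; ring.
  - rewrite jr br // forcing_Pr // eq_sym neP_r //=.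
    by rewrite !mulr0 addr0 mulr0 addr0.
  - by rewrite ir jr eqxx in ij.
have [l' b'l] := vanishes_potential b'V b'0.
exists M => s us cs os.
have : cycle_weight b' s = 0.
  rewrite -(cycle_weight_potential l' s); case: s cs {us os} => [//|x t] cs.
  by apply: (@eq_path_weight_in _ _ predT) => // i j _ _; apply: b'l.
rewrite b'E //; lra.
Qed.

(** The weight is counted by node classes, using that P has only k + 1 nodes. The sizes k + 1 and k
    + 3 must be excluded: a cycle through all of P, or through P, r and one node of Q placed just
    before r, has weight k + 1. *)
Lemma cycle_weight_forcing_le s :
    uniq s -> cycle (fun i j : 'I_n => i != j) s ->
    [|| (size s <= k)%N, (size s == k.+2)%N | (k.+4 <= size s)%N] ->
  cycle_weight forcing s <= k%:R.
Proof.
move=> us cs sk; rewrite -sum_next //.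
pose N (a : pred 'I_n) := (\sum_(x <- s) a x)%N.
have NE (a : pred 'I_n) : \sum_(x <- s) (a x)%:R = (N a)%:R :> R.
  by rewrite natr_sum.
have Ncount a : N a = count a s.
  by rewrite /N; elim: (s) => [|x t IH]; rewrite ?big_nil ?big_cons //= IH.
rewrite sumrB big_split sumrB /= (NE (mem P)) (NE (mem Q)).
rewrite (NE (fun x => (x \in Q) && (next s x == r))).
rewrite (NE (fun x => (x \in P) && (next s x == r))).
set np := N (mem P); set nq := N (mem Q).
set fq := N _; set fp := N _; pose nr := N (pred1 r).
have size_sum : (np + nq + nr = size s)%N.
  rewrite -sum1_size /np /nq /nr /N -!big_split; apply: eq_bigr => x _ /=.
  have := cover x; have [xP|_] := boolP (x \in P).
    by rewrite (negPf (disjPQ xP)) neP_r.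
  have [xQ _|_ /= ->//] := boolP (x \in Q); by rewrite neQ_r.
have np_le : (np <= k.+1)%N.
  rewrite /np Ncount -size_filter -cardP -(card_uniqP (filter_uniq _ us)).
  by apply/subset_leq_card/fintype.subsetP => x; rewrite mem_filter => /andP[].
have eq_le : (fq <= nq)%N by apply: leq_sum => x _ /=; case: (x \in Q); case: eqP.
(* If r lies on the cycle, it has a single predecessor, which differs from r and so lies in P or
   Q. *)
have pred_r : (fq + fp = nr)%N.
  have -> : nr = N (fun x => next s x == r).
    rewrite /nr !Ncount (@eq_count _ (fun x => next s x == r) (pred1 (prev s r))).
      by rewrite !count_uniq_mem // mem_prev.
    move=> x /=; apply/eqP/eqP => [<-|->]; first by rewrite prev_next.
    by rewrite next_prev.
  rewrite /fq /fp /N -big_split /=; apply: eq_big_seq => x xs.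
  have := cover x; have := next_cycle cs xs.
  have [xP|_] := boolP (x \in P); first by rewrite (negPf (disjPQ xP)).
  have [_ _ _|_] := boolP (x \in Q); first by rewrite addn0.
  by move=> /= xn /eqP xr; rewrite eq_sym -xr (negPf xn).
have nr_le : (nr <= 1)%N by rewrite /nr Ncount count_uniq_mem // leq_b1.
suff : (np + fq <= k + nq + fp)%N by rewrite -(ler_nat R) !natrD; lra.
clearbody np nq fq fp nr.
clear -size_sum np_le eq_le pred_r nr_le sk; lia.
Qed.

(** Size k gives a tight cycle, and size c_1 < k one that is not tight. *)
Lemma exists_cycle_in_P m : (0 < m <= k.+1)%N ->
  exists s, [/\ uniq s, one \in s, size s = m & cycle_weight forcing s = m%:R].
Proof.
move=> /andP[m0 mk].
have [//||t [ut tP _ st]] := @extend_in_P [:: one].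
  by move=> x; rewrite inE => /eqP->.
have sm : size (take m.-1 t) = m.-1.
  by apply: size_takel; clear -st mk m0; move: st => /=; lia.
exists (one :: take m.-1 t); split.
- move: ut => /= /andP[ot ut]; rewrite take_uniq // andbT.
  by apply: contra ot; apply: mem_take.
- by rewrite mem_head.
- by rewrite /= sm prednK.
rewrite /cycle_weight path_weight_forcing_P // ?size_rcons ?sm ?prednK //.
by move=> x; rewrite mem_rcons inE => /orP[/eqP->|/mem_take/tP].
Qed.

End ForcingWeights.

(** * Linear functionals on the arc space as arc weights *)

Section ArcFunctionals.
Variables (R : realType) (n : nat).
Implicit Types (w : 'I_n -> 'I_n -> R) (x : arc_space R n).

Definition arc_dot w x : R := \sum_a x a * w (arc_tail a) (arc_head a).

Lemma arc_dot_is_scalar w : scalar (arc_dot w).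
Proof.
move=> a x y; rewrite /arc_dot mulr_sumr -big_split; apply: eq_bigr => i _.
by rewrite !ffunE mulrDl -mulrA.
Qed.

HB.instance Definition _ w := GRing.isLinear.Build R (arc_space R n) R *%R
  (arc_dot w) (arc_dot_is_scalar w).

Lemma arc_dot_incidence w s :
    uniq s -> cycle (fun i j : 'I_n => i != j) s ->
  arc_dot w (incidence R (dicycle_of s)) = cycle_weight w s.
Proof.
move=> us cs; rewrite -sum_next // -sum_dicycle_of // [RHS]big_mkcond.
apply: eq_bigr => a _; rewrite ffunE.
by case: (a \in _); rewrite ?mul1r ?mul0r.
Qed.

Lemma arc_sumE x (F : {set Defs.arc n}) :
  arc_sum x F = \sum_a x a * (a \in F)%:R.
Proof.
rewrite /arc_sum big_mkcond; apply: eq_bigr => a _.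
by case: (a \in F); rewrite ?mulr1 ?mulr0.
Qed.

Lemma sum_arc_sum_delta_out x (S : {set 'I_n}) :
  \sum_(v in S) arc_sum x (delta_out v) = \sum_a x a * (arc_tail a \in S)%:R.
Proof.
under eq_bigr do rewrite arc_sumE.
rewrite exchange_big /=; apply: eq_bigr => a _; rewrite -mulr_sumr; congr (_ * _).
under eq_bigr do rewrite inE.
have [aS|aS] := boolP (arc_tail a \in S).
  rewrite (bigD1 (arc_tail a)) //= eqxx big1 ?addr0 // => v /andP[_ va].
  by rewrite eq_sym (negPf va).
rewrite big1 // => v vS; case: eqP => // av; by rewrite av vS in aS.
Qed.

Lemma scalar_arc_dot (g : {scalar arc_space R n}) :
  exists w, forall x, g x = arc_dot w x.
Proof.
pose e a : arc_space R n := [ffun b => (b == a)%:R].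
(* [insub] fails exactly on the diagonal pairs, which are not arcs; these get 0. *)
exists (fun i j => if insub (i, j) is Some a then g (e a) else 0) => x.
have {1}-> : x = \sum_a x a *: e a.
  apply/ffunP => b; rewrite sum_ffunE (bigD1 b) //= big1.
    by rewrite addr0 !ffunE eqxx; exact: esym (mulr1 _).
  by move=> a ab; rewrite !ffunE eq_sym (negPf ab); exact: mulr0.
rewrite linear_sum; apply: eq_bigr => a _; rewrite linearZ /=.
by rewrite /arc_tail /arc_head -surjective_pairing valK.
Qed.

End ArcFunctionals.

(** * Gaps in the cardinality sequence and the proof of the facet property *)

Lemma mem_strictly_sorted_gap (c : seq nat) i k x :
    sorted ltn c -> (i.+2 < size c)%N -> nth 0%N c i = k ->
    nth 0%N c i.+1 = k.+2 -> nth 0%N c i.+2 = k.+4 -> x \in c ->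
  [|| (x <= k)%N, x == k.+2 | (k.+4 <= x)%N].
Proof.
move=> cs ic c0 c1 c2 /(nthP 0%N)[j jc <-].
have mono a b : (a < b)%N -> (b < size c)%N -> (nth 0%N c a < nth 0%N c b)%N.
  move=> ab bc; apply: (sorted_ltn_nth ltn_trans 0%N cs) => //.
  exact: ltn_trans ab bc.
have [ji|ij|->] := ltngtP j i.
- by rewrite -c0 (ltnW (mono _ _ ji _)) // (ltn_trans _ ic) //
    (ltn_trans (ltnSn _)).
- have [ji|ij2|->] := ltngtP j i.+1; first by move: (leq_trans ij ji); rewrite ltnn.
    have [ji|ij3|->] := ltngtP j i.+2; first by move: (leq_trans ij2 ji); rewrite ltnn.
      by rewrite -c2 (ltnW (mono _ _ ij3 jc)) !orbT.
    by rewrite c2 leqnn !orbT.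
  by rewrite c1 eqxx orbT.
- by rewrite c0 leqnn.
Qed.

Theorem theorem14 (R : realType) (n : nat) (hn : (6 <= n)%N)
  (m : nat) (hm : (3 <= m)%N)
  (c : m.-tuple nat) (hc : cardinality_sequence n c)
  (hc1 : (2 <= term c 1)%N) (hcm : (term c m <= n)%N)
  (p : nat) (hp : (2 <= p <= m - 2)%N)
  (hgap1 : term c (p + 2) = (term c (p + 1) + 2)%N)
  (hgap2 : (term c (p + 1) + 2)%N = (term c p + 4)%N)
  (P Q : {set 'I_n}) (r : 'I_n)
  (hcover : P :|: Q :|: [set r]%SET = [set: 'I_n]%SET)
  (hPQ : [disjoint P & Q]) (hrP : r \notin P) (hrQ : r \notin Q)
  (one : 'I_n) (hone : nat_of_ord one = 0%N) (honeP : one \in P)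
  (hP1 : #|P| = (term c p + 1)%N)
  (hP2 : (term c p + 1)%N = (term c (p + 1) - 1)%N) :
  defines_facet (@cycle_polytope_through R n m c one)
    (fun x : arc_space R n =>
       \sum_(v in P) arc_sum x (delta_out v)
       - \sum_(v in Q) arc_sum x (delta_out v)
       + arc_sum x (arcs_between Q [set r]%SET)
       - arc_sum x (arcs_between P [set r]%SET))
    (term c p)%:R.
Proof.
have [cs cn] := hc.
move: hgap1 hgap2 hP1 hc1; rewrite /term addn2 addn1 /= => gap1 gap2 cardP c1_ge2.
(* [term] counts from 1, so c_p sits at index p - 1. *)
set k := nth 0%N c p.-1 in gap1 gap2 cardP *.
have p0 : (0 < p)%N by clear -hp; lia.
have sc : (p.-1.+2 < size c)%N by rewrite size_tuple; clear -hp; lia.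
have c_p1 : nth 0%N c p.-1.+1 = k.+2 by rewrite prednK //; clear -gap2; lia.
have c_p2 : nth 0%N c p.-1.+2 = k.+4 by rewrite prednK //; clear -gap1 gap2; lia.
have gap x : x \in c -> [|| (x <= k)%N, x == k.+2 | (k.+4 <= x)%N].
  exact: mem_strictly_sorted_gap c_p1 c_p2.
(* Since p >= 2, c_1 is an earlier term than c_p; with c_1 >= 2 this gives k >= 3. *)
have c1k : (nth 0%N c 0 < k)%N.
  apply: (sorted_ltn_nth ltn_trans 0%N cs); rewrite ?inE; clear -sc hp; lia.
have k_ge3 : (3 <= k)%N by exact: leq_trans c1k.
have nth_c i : (i <= p.-1.+2)%N -> nth 0%N c i \in tval c.
  by move=> ip; apply: mem_nth; apply: leq_ltn_trans ip sc.
have tight_sizes x : x \in [:: k; k.+2; k.+4] -> x \in tval c.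
  rewrite !inE => /or3P[] /eqP->; rewrite -?c_p2 -?c_p1; apply: nth_c;
    by clear; lia.
have {}cardP : #|P| = k.+1 by rewrite cardP addn1.
have disjPQ x : x \in P -> x \notin Q by move/(disjointFr hPQ)->.
have cover x : [|| x \in P, x \in Q | x == r].
  by have := finset.in_setT x; rewrite -hcover !inE -orbA.
have kn : (k.+4 <= n)%N.
  by have /cn/andP[] : k.+4 \in tval c by apply: tight_sizes; rewrite !inE eqxx !orbT.
(* Q has n - (k + 2) nodes, and the term c_(p+2) = k + 4 is at most n. *)
have cardQ : (1 < #|Q|)%N.
  have : #|P :|: Q :|: [set r]%SET| = n by rewrite hcover cardsT card_ord.
  rewrite !cardsU cards1 cardP; clear -kn; lia.
pose f := forcing R P Q r.
pose g1 (i j : 'I_n) : R := (i == one)%:R.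
have g1E s : uniq s -> cycle_weight g1 s = (one \in s)%:R.
  move=> us; rewrite -sum_next //; have [os|os] := boolP (one \in s).
    rewrite (bigD1_seq one) //= /g1 eqxx big1 ?addr0 // => i /negPf-> //.
  rewrite big_seq big1 // => i i_s; rewrite /g1.
  by case: eqP i_s os => // -> ->.
(* The generators of the polytope as a finite list, the form that [facet_criterion] takes. *)
pose X := [seq incidence R C | C <- enum {set Defs.arc n}
                             & `[< is_dicycle C >] && (#|C| \in tval c)].
have XP x : x \in X <-> exists s, [/\ uniq s, (1 < size s)%N, size s \in tval c
    & x = incidence R (dicycle_of s)].
  split.
    move=> /mapP[C]; rewrite mem_filter => /andP[/andP[/asboolP HC Cc] _] ->.
    have /is_dicycleP[s [us s1 ds CE]] := HC; exists s; split=> //.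
      by rewrite -(card_dicycle_of us ds) -CE.
    by rewrite CE.
  case=> s [us s1 sc' ->]; have ds := uniq_cycle_neq us s1.
  apply: map_f; rewrite mem_filter mem_enum andbT card_dicycle_of // sc' andbT.
  by apply/asboolP/is_dicycleP; exists s.
have dotX w s : uniq s -> (1 < size s)%N ->
    arc_dot w (incidence R (dicycle_of s)) = cycle_weight w s.
  by move=> us s1; apply: arc_dot_incidence => //; apply: uniq_cycle_neq.
have -> : cycle_polytope_through c one
    = [set x | conv_hull [set y | y \in X]%classic x /\ arc_dot g1 x = 1]%classic.
  apply/predeqP => x; rewrite /cycle_polytope_through /cycle_polytope /=.
  have -> : arc_sum x (delta_out one) = arc_dot g1 x.
    by rewrite arc_sumE; apply: eq_bigr => a _; rewrite inE.
  have -> : [set x | exists C : {set Defs.arc n},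
      [/\ is_dicycle C, #|C| \in c & x = incidence R C]]%classic
      = [set y | y \in X]%classic; last by [].
  apply/predeqP => y /=; split.
    case=> C [HC Cc ->]; apply: map_f; rewrite mem_filter mem_enum Cc.
    by rewrite !andbT; apply/asboolP.
  move=> /mapP[C]; rewrite mem_filter => /andP[/andP[/asboolP HC Cc] _] ->.
  by exists C.
have -> : (fun x : arc_space R n =>
       \sum_(v in P) arc_sum x (delta_out v)
       - \sum_(v in Q) arc_sum x (delta_out v)
       + arc_sum x (arcs_between Q [set r]%SET)
       - arc_sum x (arcs_between P [set r]%SET)) = arc_dot f.
  apply/funext => x; rewrite !sum_arc_sum_delta_out !arc_sumE.
  rewrite -sumrB -big_split -sumrB; apply: eq_bigr => a _ /=.
  by rewrite /f /forcing !inE !mulrBr mulrDr mulrBr.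
have cycle_in_P := @exists_cycle_in_P R n k P Q r one disjPQ hrP honeP cardP.
(* This cycle has forcing weight c_1 < k; it is the point off the face that [facet_criterion]
   requires. *)
have [s0 [us0 os0 ss0 fs0]] := cycle_in_P (nth 0%N c 0) ltac:(clear -c1_ge2 c1k; lia).
have s0_gt1 : (1 < size s0)%N by rewrite ss0.
apply: (@facet_criterion R (arc_space R n) X (arc_dot g1) (arc_dot f) _
          (incidence R (dicycle_of s0))).
- move=> x /XP[s [us s1 _ ->]]; rewrite /= dotX // g1E //.
  by case: (_ \in _); rewrite ?ler01.
- move=> x /XP[s [us s1 sc' ->]]; rewrite /= dotX //.
  apply: (cycle_weight_forcing_le _ cover) => //; last exact: gap.
  exact: uniq_cycle_neq.
- have [s [us os ss fs]] := cycle_in_P k ltac:(clear -k_ge3; lia).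
  have s1 : (1 < size s)%N by rewrite ss; clear -k_ge3; lia.
  exists (incidence R (dicycle_of s)); split.
  + apply/XP; exists s; split=> //; rewrite ss; apply: tight_sizes.
    by rewrite mem_head.
  + by rewrite /= dotX // g1E // os.
  + by rewrite /= dotX.
- apply/XP; exists s0; split=> //; rewrite ss0; exact: nth_c.
- by rewrite /= dotX // g1E // os0.
- by rewrite /= dotX // fs0 eqr_nat neq_ltn c1k.
move=> g gF g0 x /XP[s [us s1 sc' ->]]; have [w gw] := scalar_arc_dot g.
rewrite gw /= !dotX // g1E // => hs.
have os : one \in s.
  by apply: contraT => /negPf os; move/eqP: hs; rewrite os eq_sym oner_eq0.
have wV : vanishes_on_tight k P Q r one w.
  move=> t ut ot st ft.
  have t1 : (1 < size t)%N by move: st; rewrite !inE; clear -k_ge3; lia.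
  rewrite -dotX // -gw; apply: gF.
  - by apply/XP; exists t; split=> //; apply: tight_sizes.
  - by rewrite /= dotX // g1E // ot.
  - by rewrite /= dotX.
have [M wM] := vanishes_forcing cover disjPQ hrP hrQ honeP cardP k_ge3 cardQ wV.
(* At [s0] the formula reads M (c_1 - k) = 0, so M = 0. *)
move: g0; rewrite gw /= dotX // (wM s0) ?uniq_cycle_neq // fs0.
move/eqP; rewrite mulf_eq0 subr_eq0 eqr_nat (ltn_eqF c1k) orbF => /eqP M0.
by rewrite (wM s) ?uniq_cycle_neq // M0 mul0r.
Qed.
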